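(* Let $G$ be a finite, simple, connected graph with maximum degree $\Delta \ge 3$. Then $Z(G) \le (\Delta - 2)\beta(G) + 1$. Moreover, this bound is sharp: for every $\Delta \ge 3$ there exists a connected graph with maximum degree $\Delta$ attaining equality.
   Context: A vertex cover of $G$ is a set $C \subseteq V(G)$ such that every edge has at least one endpoint in $C$; $\beta(G)$ is the minimum cardinality of a vertex cover. Zero forcing process: starting from a set $B \subseteq V(G)$ of vertices colored blue (all others white), repeatedly, if a blue vertex has exactly one white neighbor, that neighbor is colored blue. $B$ is a zero forcing set if eventually all vertices become blue. $Z(G)$ is the minimum cardinality of a zero forcing set of $G$. *)

(* Defs.v *)
From mathcomp Require Import all_boot.

Set Implicit Arguments.
Unset Strict Implicit.
Unset Printing Implicit Defensive.

Record sgraph := SGraph {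
  vertex :> finType;
  edge : rel vertex;
  edge_sym : symmetric edge;
  edge_irrefl : irreflexive edge
}.

Definition nbhd (G : sgraph) (u : G) : {set G} := [set v | edge u v].

Definition max_degree (G : sgraph) : nat := \max_(u : G) #|nbhd u|.

Definition connected_graph (G : sgraph) : Prop :=
  forall u v : G, connect (@edge G) u v.

Definition vertex_cover (G : sgraph) (C : {set G}) : bool :=
  [forall u, forall v, edge u v ==> (u \in C) || (v \in C)].

(* [arg min_] falls back to its default [set: G] only if that set fails the
   predicate; [vertex_coverT] and [zero_forcingT] exclude this case. *)
Definition vertex_cover_number (G : sgraph) : nat :=
  #|[arg min_(C < [set: G] | vertex_cover C) #|C|]|.

(* One application of the color change rule: B and B' are the sets of blue
   vertices before and after the blue vertex u forces its only white
   neighbor w. *)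
Definition color_change (G : sgraph) : rel {set G} :=
  fun B B' => [exists u in B, exists w,
    (nbhd u :\: B == [set w]) && (B' == w |: B)].

(* [connect] is reachability: finitely many forces turn all vertices blue. *)
Definition zero_forcing (G : sgraph) (B : {set G}) : bool :=
  connect (@color_change G) B [set: G].

Definition zero_forcing_number (G : sgraph) : nat :=
  #|[arg min_(B < [set: G] | zero_forcing B) #|B|]|.

Lemma vertex_coverT (G : sgraph) : vertex_cover [set: G].
Proof. by apply/forallP=> u; apply/forallP=> v; rewrite inE implybT. Qed.

Lemma zero_forcingT (G : sgraph) : zero_forcing [set: G].
Proof. exact: connect0. Qed.

Lemma vertex_cover_numberP (G : sgraph) :
  (exists2 C : {set G}, vertex_cover C & #|C| = vertex_cover_number G) /\
  (forall C : {set G}, vertex_cover C -> vertex_cover_number G <= #|C|).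
Proof.
rewrite /vertex_cover_number; case: arg_minnP => [|C HC Hmin]; first exact: vertex_coverT.
by split; first exists C.
Qed.

Lemma zero_forcing_numberP (G : sgraph) :
  (exists2 B : {set G}, zero_forcing B & #|B| = zero_forcing_number G) /\
  (forall B : {set G}, zero_forcing B -> zero_forcing_number G <= #|B|).
Proof.
rewrite /zero_forcing_number; case: arg_minnP => [|B HB Hmin]; first exact: zero_forcingT.
by split; first exists B.
Qed.

(* Main.v *)
Require Import Defs.
From mathcomp Require Import all_boot.

(**
  Add the vertices of a minimum vertex cover [C] one at a time, each new one
  [c] adjacent to the part of the graph already reached: the chosen part [S] of
  the cover together with its neighbours outside [C].  A vertex that [c] newly
  brings in is, in the enlarged induced subgraph, a leaf attached to [c].  If
  there are at least two of them, colour all but one: a coloured leaf forces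
  [c], the old forcing process runs unhindered, and [c] forces the last leaf.
  Otherwise colour [c] itself.  Since [c] has a neighbour in the old part, this
  costs at most [Delta - 2]; only the first vertex of the cover may cost
  [Delta - 1].  Stars attain the bound.
*)

Set Implicit Arguments.
Unset Strict Implicit.
Unset Printing Implicit Defensive.

Lemma connect_invariant (T : finType) (e : rel T) (P : pred T) (x y : T) :
  (forall z t, e z t -> P z -> P t) -> connect e x y -> P x -> P y.
Proof.
move=> eP /connectP[p + ->]; elim: p x => //= z p IHp x /andP[exz pz] Px.
exact: IHp pz (eP _ _ exz Px).
Qed.

(** * Forcing inside induced subgraphs *)

Section UpperBound.

Variable G : sgraph.
Implicit Types (u v w c : G) (B S U X : {set G}).

Lemma nbhd_sym u v : (u \in nbhd v) = (v \in nbhd u).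
Proof. by rewrite !inE edge_sym. Qed.

Lemma nbhd_irrefl u : u \notin nbhd u.
Proof. by rewrite inE edge_irrefl. Qed.

Lemma card_nbhd u : #|nbhd u| <= max_degree G.
Proof. exact: (leq_bigmax (F := fun u : G => #|nbhd u|)). Qed.

(* The color change rule of the subgraph induced by [U], for [B \subset U]. *)
Definition color_change_in U : rel {set G} :=
  fun B B' => [exists u in B, exists w,
    ((nbhd u :&: U) :\: B == [set w]) && (B' == w |: B)].

Lemma color_change_inT : color_change_in [set: G] =2 @color_change G.
Proof.
move=> B B'; rewrite /color_change_in /color_change.
by under eq_existsb => u do under eq_existsb => w do rewrite setIT.
Qed.

Lemma connect_force U B u w :
  u \in B -> (nbhd u :&: U) :\: B = [set w] ->
  connect (color_change_in U) B (w |: B).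
Proof.
move=> uB uw; apply/connect1/existsP; exists u; rewrite uB.
by apply/existsP; exists w; rewrite uw !eqxx.
Qed.

(** With [X] blue, a vertex of [U] has the same white neighbours in [U'] as in [U], so every old
    force stays valid; the forced vertex lies in [U], hence outside [X]. *)
Lemma connect_color_change_extend U U' X B B' :
    (forall u, u \in U -> (nbhd u :&: U') :\: X = (nbhd u :&: U) :\: X) ->
    [disjoint X & U] -> B \subset U ->
    connect (color_change_in U) B B' ->
  connect (color_change_in U') (X :|: B) (X :|: B').
Proof.
move=> nbhdX XU + /connectP[p + ->].
elim: p B => [|B1 p IHp] B BU /=; first by rewrite connect0.
case/andP=> /existsP[u /andP[uB /existsP[w /andP[/eqP uw /eqP B1E]]]] pB1.
have /setDP[/setIP[_ wU] _] : w \in (nbhd u :&: U) :\: B by rewrite uw set11.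
have uU : u \in U by apply: subsetP uB.
have B1U : B1 \subset U by rewrite B1E subUset sub1set wU.
apply: connect_trans (IHp _ B1U pB1); rewrite B1E setUCA.
apply: (@connect_force _ _ u); first by rewrite inE uB orbT.
rewrite -setDDl (nbhdX u uU) setDDl setUC -setDDl uw.
apply/setDidPl; rewrite disjoint_sym (disjointWr _ XU) //.
by rewrite sub1set.
Qed.

(** * The part reached by a piece of the cover, and its growth by one vertex *)

Variable C : {set G}.
Hypothesis coverC : vertex_cover C.

Lemma cover_edge u v : v \in nbhd u -> (u \in C) || (v \in C).
Proof.
by rewrite inE => uv; move/forallP/(_ u)/forallP/(_ v)/implyP: coverC; apply.
Qed.

(** Neighbours in [C] stay out until they are chosen themselves; this is what makes the other
    newcomers leaves. *)
Definition reached S : {set G} :=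
  S :|: [set v | (v \notin C) && [exists c in S, v \in nbhd c]].

Lemma reached0 : reached set0 = set0.
Proof.
apply/setP=> v; rewrite !inE /=; apply/negP=> /andP[_ /existsP[c]].
by rewrite inE.
Qed.

Lemma reached_cover S v : v \in C -> (v \in reached S) = (v \in S).
Proof. by move=> vC; rewrite !inE vC orbF. Qed.

Lemma reached_nbhd S c v : c \in S -> v \in nbhd c -> v \notin C ->
  v \in reached S.
Proof.
move=> cS vc vC; rewrite !inE vC; apply/orP; right; apply/existsP.
by exists c; rewrite cS.
Qed.

Lemma reachedU1 S c :
  reached (c |: S) = c |: ((nbhd c :\: C :\: reached S) :|: reached S).
Proof.
apply/setP=> v; rewrite /reached 6!inE.
have [->|vc] /= := eqVneq v c; first by [].
have -> : [exists x in c |: S, v \in nbhd x] =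
          (v \in nbhd c) || [exists x in S, v \in nbhd x].
  apply/existsP/orP =>
    [[x /andP[/setU1P[->|xS] vx]]|[vc'|/existsP[x /andP[xS vx]]]].
  - by left.
  - by right; apply/existsP; exists x; rewrite xS.
  - by exists c; rewrite setU11.
  - by exists x; rewrite setU1r.
rewrite !inE.
by case: (v \in S); case: (v \in C); case: (edge c v); case: [exists x in S, _].
Qed.

(** A new vertex lies outside [C], so its neighbours lie in [C]; one in [S] would have made it
    reached earlier. Within the enlarged part only [c] remains. In the cost, [1] pays for [c] itself
    and [.-1] spares one leaf. *)
Lemma forcing_step S c B :
    S \subset C -> c \in C :\: S ->
    B \subset reached S ->
    connect (color_change_in (reached S)) B (reached S) ->
  exists B' : {set G},
    [/\ B' \subset reached (c |: S),
        connect (color_change_in (reached (c |: S))) B' (reached (c |: S)) &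
        #|B'| <= #|B| + maxn 1 #|nbhd c :\: C :\: reached S|.-1].
Proof.
set U := reached S; set L := nbhd c :\: C :\: U => SC /setDP[cC cS] BU fB.
have cU : c \notin U by rewrite reached_cover.
have UE : reached (c |: S) = c |: (L :|: U) by rewrite reachedU1.
rewrite UE.
have LP v : v \in L -> [/\ v \notin U, v \notin C & v \in nbhd c].
  by move=> /setDP[/setDP[? ?] ?].
have cL : c \notin L by apply/negP=> /LP[_ /negP].
have LU u v : u \in U -> v \in L -> v \notin nbhd u.
  move=> uU /LP[vU vC vc]; apply/negP=> vu.
  have uC : u \in C by have := cover_edge vu; rewrite (negPf vC) orbF.
  by rewrite (reached_nbhd (c := u)) // -?(reached_cover S uC) in vU.
have LL v u : v \in L -> u \in L -> u \notin nbhd v.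
  move=> /LP[_ vC _] /LP[_ uC _]; apply/negP=> /cover_edge.
  by rewrite (negPf vC) (negPf uC).
clearbody L; clearbody U.
(* Vertices of [U] see no leaf in [L], so [c] is the only new neighbour they can have, and it is
   already blue. *)
have extend X : c \in X -> X \subset c |: L ->
    connect (color_change_in (c |: (L :|: U))) (X :|: B) (X :|: U).
  move=> cX XL; apply: connect_color_change_extend BU fB => [u uU|].
    apply/setP=> v; rewrite !in_setD !in_setI in_setU1 in_setU.
    have [->|_] := eqVneq v c; first by rewrite cX.
    by case: (boolP (v \in L)) => // /(LU u v uU)/negPf->; rewrite !andbF.
  rewrite (disjointWl XL) // disjoint_subset; apply/subsetP=> v.
  by move=> /setU1P[->|/LP[vU _ _]]; rewrite inE.
(* At most one leaf: colour [c], which forces that leaf, if any, once [U] is blue. *)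
have [L1|L1] := leqP #|L| 1.
  exists (c |: B); split.
  - by apply: setUS; apply: subset_trans BU (subsetUr _ _).
  - apply: connect_trans (extend [set c] (set11 c) (subsetUl _ _)) _.
    have [->|/set0Pn[v vL]] := eqVneq L set0; first by rewrite set0U connect0.
    have LE : L = [set v].
      by apply/esym/eqP; rewrite eqEcard sub1set vL cards1.
    have [vU _ vc] := LP v vL.
    rewrite LE setUCA; apply: (@connect_force _ _ c); first by rewrite setU11.
    apply/setP=> x; rewrite !in_setD !in_setI !in_setU !in_set1.
    have [->|xv] := eqVneq x v.
      by rewrite (negPf vU) vc !orbF andbT; apply: contraTneq vL => ->.
    by case: (x == c) (x \in U) => [] [] //=; rewrite andbF.
  - by rewrite cardsU1 addnC leq_add2l (leq_trans (leq_b1 _)) ?leq_maxl.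
(* The leaf [l2] is left white, for [c] to force at the very end; another leaf [l1] forces [c] at
   the start. *)
have [l2 l2L] : exists l2, l2 \in L by apply/set0Pn; rewrite -card_gt0 ltnW.
have L2card : #|L :\ l2| = #|L|.-1 by rewrite (cardsD1 l2 L) l2L.
have [l1 l1L2] : exists l1, l1 \in L :\ l2.
  by apply/set0Pn; rewrite -card_gt0 L2card -ltnS prednK // ltnW.
have l1L : l1 \in L by case/setD1P: l1L2.
have [l1U _ l1c] := LP l1 l1L; have [l2U _ l2c] := LP l2 l2L.
exists ((L :\ l2) :|: B); split.
- apply: subset_trans (subsetUr _ _).
  by apply: setUSS BU; apply: subD1set.
- apply: (@connect_trans _ _ ((c |: (L :\ l2)) :|: B)).
    rewrite -setUA; apply: (@connect_force _ _ l1).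
      by rewrite inE l1L2.
    apply/setP=> x; rewrite in_setD in_setI in_setU1 !in_setU in_set1.
    have [->|xc] /= := eqVneq x c.
      rewrite nbhd_sym l1c in_setD1 (negPf cL) andbF andbT /=.
      by rewrite andbT; apply/negP=> /(subsetP BU _); apply/negP.
    have [xL|_] := boolP (x \in L).
      by rewrite (negPf (LL _ _ l1L xL)) andbF.
    have [xU|_] := boolP (x \in U); last by rewrite !andbF.
    by rewrite nbhd_sym (negPf (LU _ _ xU l1L)) andbF.
  apply: connect_trans (extend _ (setU11 _ _) (setUS _ (subD1set _ _))) _.
  have -> : c |: (L :|: U) = l2 |: ((c |: L :\ l2) :|: U).
    by rewrite -{1}(setD1K l2L) -!setUA setUCA.
  apply: (@connect_force _ _ c); first by rewrite !inE eqxx.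
  apply/setP=> x; rewrite !in_setD !in_setI !in_setU !in_set1.
  have [->|xl2] := eqVneq x l2.
    rewrite (negPf l2U) l2c setD11 !orbF andbT.
    by apply: contraTneq l2L => ->.
  by case: ((x == c) || _ || _); rewrite ?andbF.
- apply: leq_trans (leq_card_setU _ _) _.
  by rewrite L2card addnC leq_add2l leq_maxr.
Qed.

(** * Exhausting the cover of a connected graph *)

Hypothesis connG : connected_graph G.

(** Otherwise [reached S] is closed under adjacency, hence everything by connectedness, which forces
    [C] into [S]. *)
Lemma reached_extend S : S \subset C -> S != set0 -> S != C ->
  exists2 c, c \in C :\: S & exists2 u, u \in reached S & u \in nbhd c.
Proof.
move=> SC /set0Pn[s sS] SneqC.
have [/existsP[c /andP[cCS /existsP[u /andP[uS uc]]]]|/existsPn noc] :=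
    boolP [exists c in C :\: S, exists u in reached S, u \in nbhd c].
  by exists c => //; exists u.
have closedS : closed (@edge G) (mem (reached S)).
  apply: intro_closed => [|u v uv uS]; first exact/sym_connect_sym/edge_sym.
  have vu : v \in nbhd u by rewrite inE.
  have [vC|vC] := boolP (v \in C).
    rewrite /= reached_cover //; apply: contraT => vS.
    have /negP[] := noc v; rewrite inE vS vC /=.
    by apply/existsP; exists u; rewrite uS nbhd_sym.
  have uC : u \in C by have := cover_edge vu; rewrite (negPf vC) orbF.
  by apply: (@reached_nbhd _ u) => //; rewrite -(reached_cover _ uC).
case/negP: SneqC; rewrite eqEsubset SC; apply/subsetP=> c cC.
rewrite -(reached_cover S cC) -(closed_connect closedS (connG s c)).
by rewrite inE sS.
Qed.

Hypothesis deg3 : 3 <= max_degree G.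

(** Induction on [j]: the summand [1] is spent on the first cover vertex, and [deg3] gives
    [max_degree G - 2 >= 1], so later steps that colour [c] itself stay within budget. *)
Lemma forcing_reached j : 0 < j <= #|C| ->
  exists S B : {set G},
    [/\ S \subset C, #|S| = j, B \subset reached S,
        connect (color_change_in (reached S)) B (reached S) &
        #|B| <= (max_degree G - 2) * j + 1].
Proof.
elim: j => // j IHj /= ltjC.
have [j0|j_gt0] := posnP j.
  have [c cC] : exists c, c \in C.
    by apply/set0Pn; rewrite -card_gt0 (leq_trans _ ltjC).
  have [|||B [BU fB Bcard]] := @forcing_step set0 c set0 (sub0set _).
  - by rewrite setD0.
  - exact: sub0set.
  - by rewrite reached0 connect0.
  exists (c |: set0), B; rewrite setU0 in BU fB *; split=> //.
  - by rewrite sub1set.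
  - by rewrite cards1 j0.
  rewrite j0 muln1; apply: leq_trans Bcard _.
  rewrite cards0 add0n geq_max addn1 ltnS leq0n /=.
  (* All neighbours of the first vertex may be new leaves. *)
  have Lc : #|nbhd c :\: C :\: reached set0| <= max_degree G.
    apply: leq_trans (card_nbhd c).
    by rewrite subset_leq_card // setDDl subsetDl.
  move: Lc deg3; case: (max_degree G) => [|[|m]] //.
  by case: #|_| => [|k] //; rewrite subn2.
have [|S [B [SC Sj BU fB Bcard]]] := IHj; first by rewrite j_gt0 ltnW.
have [||c cCS [u uS uc]] := @reached_extend S SC.
- by rewrite -card_gt0 Sj.
- by apply: contraTneq ltjC => <-; rewrite Sj ltnn.
have [B' [BU' fB' Bcard']] := forcing_step SC cCS BU fB.
have [cC cS] := setDP cCS.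
exists (c |: S), B'; split=> //.
- by rewrite subUset sub1set cC.
- by rewrite cardsU1 cS Sj.
apply: leq_trans Bcard' _; rewrite mulnSr addnAC leq_add // geq_max.
rewrite subn_gt0 deg3 /=.
(* Strict, since the neighbour [u] of [c] is already reached. *)
have Lc : #|nbhd c :\: C :\: reached S| < max_degree G.
  apply: leq_trans (card_nbhd c); rewrite proper_card // properE.
  rewrite setDDl subsetDl /=; apply/subsetPn; exists u => //.
  by rewrite in_setD in_setU uS orbT.
move: Lc deg3; case: (max_degree G) => [|[|m]] //.
by case: #|_| => [|k] //; rewrite subn2.
Qed.

Lemma zero_forcing_number_cover :
  zero_forcing_number G <= (max_degree G - 2) * #|C| + 1.
Proof.
(* No vertex is isolated: on a single vertex all degrees would be at most 1. Hence every vertex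
   outside [C] has a neighbour in [C], and [reached C] is the whole graph. *)
have nbr_exists v : exists w, w \in nbhd v.
  have [u dv] : exists u : G, u != v.
    apply/existsP; apply: contraLR deg3; rewrite negb_exists => /forallP allv.
    rewrite -leqNgt (leq_trans _ (leqnSn 1)) //.
    apply/bigmax_leqP => u _; rewrite -(cards1 v) subset_leq_card //.
    by apply/subsetP=> w _; rewrite inE; have := allv w; rewrite negbK.
  have /connectP[[|w p] /= pv uE] := connG v u; first by rewrite uE eqxx in dv.
  by exists w; rewrite inE; case/andP: pv.
have v0 : G.
  have : 0 < #|G|.
    apply: contraTT deg3; rewrite -eqn0Ngt => /eqP/card0_eq G0.
    by rewrite /max_degree big_pred0.
  by case/card_gt0P/sigW.
have Cgt0 : 0 < #|C|.
  have [w v0w] := nbr_exists v0; rewrite card_gt0; apply/set0Pn.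
  by case/orP: (cover_edge v0w) => ?; [exists v0 | exists w].
have [|S [B [SC SE _ fB Bcard]]] := @forcing_reached #|C|.
  by rewrite Cgt0 leqnn.
have {SC SE}SC : S = C by apply/eqP; rewrite eqEcard SC SE leqnn.
have UT : reached S = [set: G].
  apply/setP=> v; rewrite in_setT SC; have [vC|vC] := boolP (v \in C).
    by rewrite reached_cover.
  have [w vw] := nbr_exists v.
  apply: (@reached_nbhd _ w) => //; last by rewrite nbhd_sym.
  by have := cover_edge vw; rewrite (negPf vC).
apply: leq_trans Bcard; apply: (zero_forcing_numberP G).2.
by rewrite /zero_forcing -(eq_connect color_change_inT) -UT.
Qed.

End UpperBound.

(** * Sharpness: stars *)

Section Star.

Variable d : nat.

(** [None] is the centre and the [Some i] are the [d] leaves. *)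
Definition star_edge : rel (option 'I_d) := fun u v => isSome u (+) isSome v.

Lemma star_edge_sym : symmetric star_edge.
Proof. by move=> u v; apply: addbC. Qed.

Lemma star_edge_irrefl : irreflexive star_edge.
Proof. by move=> u; apply: addbb. Qed.

Definition star : sgraph := SGraph star_edge_sym star_edge_irrefl.

Lemma star_connected : connected_graph star.
Proof.
have to_center (u : star) : connect (@edge star) u None.
  by case: u => [i|]; [apply: connect1 | apply: connect0].
move=> u v; apply: connect_trans (to_center u) _.
by rewrite (sym_connect_sym (@edge_sym star)) to_center.
Qed.

Lemma star_max_degree : 0 < d -> max_degree star = d.
Proof.
move=> d_gt0; apply/eqP; rewrite eqn_leq; apply/andP; split.
  apply/bigmax_leqP => -[i|] _.
    rewrite (leq_trans _ d_gt0) // -(cards1 (None : star)) subset_leq_card //.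
    by apply/subsetP=> -[j|]; rewrite !inE.
  rewrite -[X in _ <= X]card_ord.
  rewrite -(card_imset _ (Some_inj : injective (@Some 'I_d))) subset_leq_card //.
  by apply/subsetP=> -[j|]; rewrite !inE // => _; apply: imset_f.
apply: leq_trans (card_nbhd (None : star)).
rewrite -[X in X <= _]card_ord -cardsT.
rewrite -(card_imset _ (Some_inj : injective (@Some 'I_d))).
by apply/subset_leq_card/subsetP=> _ /imsetP[i _ ->]; rewrite inE.
Qed.

Lemma star_vertex_cover_number : 0 < d -> vertex_cover_number star = 1.
Proof.
move=> d_gt0; apply/eqP; rewrite eqn_leq; apply/andP; split.
  rewrite -(cards1 (None : star)); apply: (vertex_cover_numberP star).2.
  by apply/forallP=> -[i|]; apply/forallP=> -[j|]; rewrite !inE.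
have [[C coverC <-] _] := vertex_cover_numberP star.
have := @cover_edge star C coverC None (Some (Ordinal d_gt0)).
rewrite inE => /(_ isT) CNS; rewrite card_gt0; apply/set0Pn.
by case/orP: CNS => ?; [exists None | exists (Some (Ordinal d_gt0))].
Qed.

(* Two white leaves stay white forever: only the centre could force them. *)
Lemma star_zero_forcing_leaf (B : {set star}) (i j : 'I_d) :
  zero_forcing B -> i != j -> (Some i \in B) || (Some j \in B).
Proof.
move=> fB ij; apply: contraT => nB.
suff : (Some i \notin [set: star]) && (Some j \notin [set: star]) by rewrite !inE.
move: nB; rewrite negb_or; move: fB.
apply: (connect_invariant
  (P := fun B : {set star} => (Some i \notin B) && (Some j \notin B))).
move=> {}B B' /existsP[u /andP[uB /existsP[w /andP[/eqP uw /eqP->]]]] /andP[iB jB].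
have wE x : x \notin B -> edge u x -> x = w.
  by move=> xB ux; apply/set1P; rewrite -uw in_setD xB inE.
have : w \in nbhd u :\: B by rewrite uw set11.
rewrite !inE => /andP[wB uwe].
case: u {uB uw} wE uwe => [k|] wE uwe.
  by case: w uwe {wE wB} => [l|] // _; rewrite /= iB jB.
(* Here [u] is the centre, and both white leaves would have to be its only white neighbour [w]. *)
have wi := wE _ iB isT; have := wE _ jB isT; rewrite -wi => -[ji].
by rewrite ji eqxx in ij.
Qed.

(** A zero forcing set misses at most one leaf. *)
Lemma star_zero_forcing_number : d.-1 <= zero_forcing_number star.
Proof.
have [[B fB <-] _] := zero_forcing_numberP star.
pose L := [set i : 'I_d | Some i \in B].
have LB : #|L| <= #|B|.
  rewrite -(card_imset _ (Some_inj : injective (@Some 'I_d))) subset_leq_card //.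
  by apply/subsetP=> _ /imsetP[i + ->]; rewrite inE.
apply: leq_trans LB; rewrite -subn1 leq_subLR -[X in X <= _]card_ord -(cardsC L).
rewrite addnC leq_add2r; apply/card_le1_eqP => i j; rewrite !inE => iB jB.
apply/eqP; apply: contraT => /(star_zero_forcing_leaf fB).
by rewrite (negPf iB) (negPf jB).
Qed.

End Star.

Theorem theorem2 :
  (forall G : sgraph,
     connected_graph G ->
     3 <= max_degree G ->
     zero_forcing_number G
       <= (max_degree G - 2) * vertex_cover_number G + 1)
  /\
  (forall d : nat, 3 <= d ->
     exists G : sgraph,
       [/\ connected_graph G,
           max_degree G = d &
           zero_forcing_number G = (d - 2) * vertex_cover_number G + 1]).
Proof.
have upper (G : sgraph) : connected_graph G -> 3 <= max_degree G ->
    zero_forcing_number G <= (max_degree G - 2) * vertex_cover_number G + 1.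
  move=> connG deg3; have [[C coverC <-] _] := vertex_cover_numberP G.
  exact: zero_forcing_number_cover.
split=> // d d3; have d_gt0 : 0 < d by apply: leq_trans d3.
exists (star d); split; [exact: star_connected | exact: star_max_degree |].
apply/eqP; rewrite eqn_leq -{2}(star_max_degree d_gt0) upper //=; last first.
- by rewrite star_max_degree.
- exact: star_connected.
(* With cover number 1 the bound is [d - 2 + 1], that is [d.-1]. *)
rewrite star_vertex_cover_number // muln1.
apply: leq_trans (star_zero_forcing_number d).
by rewrite addn1 -subn1 -subSn ?subSS // ltnW.
Qed.
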